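(* Let $E$ be a non-zero Banach space and let $*,\diamond\in\mathrm{Mltp}_{\mathrm{u}}(E)$, with unit elements $e_*$ and $e_\diamond$ respectively. Then $$\|e_\diamond-e_*\|\leq|\diamond-*|\,\|e_\diamond\|\,\|e_*\|.$$
   Context: $\mathrm{B}_2(E)$ is the Banach space of bounded bilinear maps $E\times E\to E$ with the operator norm $|\varphi|=\sup\{\|\varphi(x,y)\|:\|x\|\leq1,\|y\|\leq1\}$. $\mathrm{Mltp}_{\mathrm{u}}(E)\subset\mathrm{B}_2(E)$ is the set of those $*\in\mathrm{B}_2(E)$ that are associative as binary operations on $E$ and for which the algebra $(E,* )$ has a (two-sided) unit element, denoted $e_*$. *)

(* Defs.v *)
From HB Require Import structures.
From mathcomp Require Export all_boot all_order all_algebra.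
From mathcomp Require Export sesquilinear.
From mathcomp Require Export complex.
From mathcomp Require Export boolp classical_sets reals topology normedtype.

Set Implicit Arguments.
Unset Strict Implicit.
Unset Printing Implicit Defensive.

Import Order.TTheory GRing.Theory Num.Theory.
Import numFieldNormedType.Exports.

Local Open Scope classical_set_scope.
Local Open Scope ring_scope.
Local Open Scope complex_scope.

(* The scalar field of a Banach space is either R or C = R[i]. *)
Variant scalar_kind := RealScalars | ComplexScalars.

Definition scalar_field (R : realType) (k : scalar_kind) : numFieldType :=
  match k with
  | RealScalars => R
  | ComplexScalars => R[i]
  end.

Section BilinearMaps.
Context {K : numFieldType} {E : completeNormedModType K}.

Definition ball_norms (phi : E -> E -> E) : set K :=
  [set r | exists x y : E, [/\ `|x| <= 1, `|y| <= 1 & r = `|phi x y|]].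

(* Norms are K-valued, so for K = R[i] the supremum is taken for the partial
   order of R[i], in which every upper bound of a nonempty set of real numbers
   is itself real; it is therefore the usual supremum in R.  As with [sup], the
   value is 0 by convention when [phi] is not bounded. *)
Definition opnorm (phi : E -> E -> E) : K := supremum 0 (ball_norms phi).

Definition B2 : set {bilinear E -> E -> E} :=
  [set phi | has_ubound (ball_norms phi)].

Definition is_unit_elt (op : E -> E -> E) (e : E) : Prop :=
  left_id e op /\ right_id e op.

Definition Mltpu : set {bilinear E -> E -> E} :=
  [set op | [/\ B2 op, associative op & exists e : E, is_unit_elt op e]].

End BilinearMaps.

Arguments B2 {K} E.
Arguments Mltpu {K} E.

(* Main.v *)
Require Import Defs.
Import Order.TTheory GRing.Theory Num.Theory.
Import numFieldNormedType.Exports.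
Local Open Scope classical_set_scope.
Local Open Scope ring_scope.

(** Write [phi] for the difference [diam - star].  Evaluating it at the pair
    [(e_diam, e_star)] makes each product collapse, since one of the two
    arguments is a unit for it:
    [diam e_diam e_star = e_star] and [star e_diam e_star = e_diam].  Hence
    [phi e_diam e_star = e_star - e_diam], and the theorem is the inequality
    [`|phi x y| <= opnorm phi * `|x| * `|y|] at this pair.

    That inequality ([homogeneous_le_opnorm]) follows by scaling [x] and [y] to
    the unit sphere, provided that [opnorm phi] is an upper bound of the values
    of [`|phi x y|] on the unit ball.  The operator norm is a supremum for the
    order of the scalar field, and this order is only partial on [R[i]], so the
    existence of the least upper bound has to be established: it is the least
    upper bound in [R] of the real parts ([scalar_supremums_neq0]). *)

(** Over [R[i]], comparable elements have equal imaginary parts.  So a set of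
    nonnegative elements and all its upper bounds lie on the real axis, where
    the order is that of [R], which is complete. *)
Lemma scalar_supremums_neq0 (R : realType) (k : scalar_kind)
    (A : set (scalar_field R k)) :
  A !=set0 -> (forall r, A r -> 0 <= r) -> has_ubound A ->
  supremums A !=set0.
Proof.
case: k A => /= A A_neq0 A_ge0 [M AM].
  exists (sup A); split; first by apply: ub_le_sup; exists M.
  by move=> N AN; exact: ge_sup.
have A_real z : A z -> (complex.Re z)%:C%C = z.
  by move=> Az; apply/RRe_real/ger0_real/A_ge0.
pose B : set R := [set complex.Re z | z in A].
have B_neq0 : B !=set0 by case: A_neq0 => z Az; exists (complex.Re z), z.
have ubB N : ubound A N -> ubound B (complex.Re N).
  by move=> AN _ [z Az <-]; have := AN _ Az; rewrite lecE => /andP[].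
exists (sup B)%:C%C; split.
  move=> z Az; rewrite -(A_real _ Az) lecR; apply: ub_le_sup; last by exists z.
  by exists (complex.Re M); exact: ubB.
move=> N AN; case: A_neq0 => z Az.
have N_real : N \is Num.real by rewrite ger0_real// (le_trans (A_ge0 _ Az))// AN.
by rewrite -(RRe_real N_real) lecR; apply: ge_sup => //; exact: ubB.
Qed.

Lemma ball_norm_le_opnorm (R : realType) (k : scalar_kind)
    (E : completeNormedModType (scalar_field R k)) (phi : E -> E -> E) (x y : E) :
  has_ubound (ball_norms phi) -> `|x| <= 1 -> `|y| <= 1 ->
  `|phi x y| <= opnorm phi.
Proof.
move=> phi_bnd x1 y1; have phixy : ball_norms phi `|phi x y| by exists x, y.
have norms_neq0 : ball_norms phi !=set0 by exists `|phi x y|.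
have : supremums (ball_norms phi) !=set0.
  by apply: scalar_supremums_neq0 => // _ [u [v [_ _ ->]]].
rewrite /opnorm /supremum; case: ifPn => [/eqP phi0|_ /(xgetPex 0)[ub _]].
  by move: phixy; rewrite phi0.
exact: ub.
Qed.

(** Scaling [x] and [y] to norm one reduces the bound to the unit ball.  The
    hypothesis on [phi] is joint homogeneity, which a pointwise difference of
    bilinear maps inherits by direct computation. *)
Lemma homogeneous_le_opnorm (R : realType) (k : scalar_kind)
    (E : completeNormedModType (scalar_field R k)) (phi : E -> E -> E) (x y : E) :
  (forall a b u v, phi (a *: u) (b *: v) = (a * b) *: phi u v) ->
  has_ubound (ball_norms phi) ->
  `|phi x y| <= opnorm phi * `|x| * `|y|.
Proof.
move=> phiZ phi_bnd.
have phi0l v : phi 0 v = 0.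
  by rewrite -[X in phi X v](scale0r 0) -[v]scale1r phiZ mul0r scale0r.
have phi0r u : phi u 0 = 0.
  by rewrite -[X in phi u X](scale0r 0) -[u]scale1r phiZ mulr0 scale0r.
have [->|x_neq0] := eqVneq x 0; first by rewrite phi0l !normr0 mulr0 mul0r.
have [->|y_neq0] := eqVneq y 0; first by rewrite phi0r !normr0 mulr0.
have x_gt0 : 0 < `|x| by rewrite normr_gt0.
have y_gt0 : 0 < `|y| by rewrite normr_gt0.
have : `|phi (`|x|^-1 *: x) (`|y|^-1 *: y)| <= opnorm phi.
  by apply: ball_norm_le_opnorm; rewrite ?normfZV.
rewrite phiZ normrZ normrM !normfV !normr_id -invfM mulrC.
by rewrite ler_pdivrMr ?mulr_gt0// mulrA.
Qed.

Lemma has_ubound_ball_normsB (K : numFieldType) (E : completeNormedModType K)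
    (phi psi : E -> E -> E) :
  has_ubound (ball_norms phi) -> has_ubound (ball_norms psi) ->
  has_ubound (ball_norms (fun x y => phi x y - psi x y)).
Proof.
move=> [M phiM] [N psiN]; exists (M + N) => _ [x [y [x1 y1 ->]]].
rewrite (le_trans (ler_normB _ _))// lerD//.
  by apply: phiM; exists x, y.
by apply: psiN; exists x, y.
Qed.

Theorem theorem2p3 (R : realType) (k : scalar_kind)
    (E : completeNormedModType (scalar_field R k))
    (E_neq0 : exists x : E, x != 0)
    (star diam : {bilinear E -> E -> E})
    (star_Mltpu : Mltpu E star) (diam_Mltpu : Mltpu E diam)
    (e_star e_diam : E)
    (e_starP : is_unit_elt star e_star) (e_diamP : is_unit_elt diam e_diam) :
  `|e_diam - e_star|
    <= opnorm (fun x y => diam x y - star x y) * `|e_diam| * `|e_star|.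
Proof.
have [_ star_e] := e_starP; have [diam_e _] := e_diamP.
have [star_bnd _ _] := star_Mltpu; have [diam_bnd _ _] := diam_Mltpu.
rewrite distrC -{1}(diam_e e_star) -{2}(star_e e_diam).
apply: (@homogeneous_le_opnorm _ _ _ (fun x y => diam x y - star x y)).
  by move=> a b u v; rewrite !linearZl_LR !linearZr_LR /= !scalerA -scalerBr.
exact: has_ubound_ball_normsB.
Qed.
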